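(* Let $\mathcal{S}$ be a selection function, let $L$ be an $\mathcal{S}$-frame, and let $\nabla: L\to\mathcal{C}_{\mathcal{S}}L$, $a\mapsto\nabla_a=\{(x,y)\in L\times L: x\vee a=y\vee a\}$, be the embedding of $L$ into its congruence frame $\mathcal{C}_{\mathcal{S}}L$ (the frame of all $\mathcal{S}$-congruences on $L$), regarded as an $\mathcal{S}$-frame map. Then: (a) The map $\nabla$ is closed if and only if $\nabla$ is an isomorphism. (b) The map $\nabla$ is open if and only if $L$ is a Boolean frame (that is, a frame in which every element is complemented).
   Context: A meet-semilattice is a partially ordered set in which all finite subsets (including $\emptyset$) have a meet; its top element is $1$. A meet-semilattice map preserves finite meets (including $1$). A sub meet-semilattice is a subset for which the inclusion is a meet-semilattice map. A selection function $\mathcal{S}$ assigns to each meet-semilattice $A$ a collection $\mathcal{S}A$ of subsets of $A$ (the designated subsets of $A$), such that for all meet-semilattices $A,B$: (S1) $\{x\}\in\mathcal{S}A$ for all $x\in A$. (S2) If $G,H\in\mathcal{S}A$ then $\{x\wedge y: x\in G,y\in H\}\in\mathcal{S}A$. (S2)$'$ If $G,H\in\mathcal{S}A$ then $\{x\vee y:x\in G,y\in H\}\in\mathcal{S}A$ (when these joins exist). (S3) If $G\in\mathcal{S}A$ and, for all $x\in G$, $x=\bigvee H_x$ for some $H_x\in\mathcal{S}A$, then $\bigcup_{x\in G}H_x\in\mathcal{S}A$. (S4) For any meet-semilattice map $f:A\to B$, $\mathcal{S}(f[A])=\{f[G]:G\in\mathcal{S}A\}\subseteq\mathcal{S}B$.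 (SSub) If $B$ is a sub meet-semilattice of $A$, $G\subseteq B$ and $G\in\mathcal{S}A$, then $G\in\mathcal{S}B$. (SFin) Every finite subset of $A$ is in $\mathcal{S}A$. (SCov) If $G\subseteq H$ and $H\in\mathcal{S}A$ with $\bigvee H=1$, then $G\in\mathcal{S}A$. (SRef) If $X,Y\subseteq A$, $X\in\mathcal{S}A$ and $X\le Y$ (i.e. each $x\in X$ lies below some $y\in Y$), then there is $C\in\mathcal{S}A$ with $X\le C\subseteq Y$. An $\mathcal{S}$-frame is a meet-semilattice $L$ in which every designated subset has a join and $a\wedge\bigvee B=\bigvee_{b\in B}(a\wedge b)$ for all $a\in L$ and all designated $B\subseteq L$. In particular $L$ is a bounded distributive lattice. An $\mathcal{S}$-frame map is a meet-semilattice map $f:L\to M$ between $\mathcal{S}$-frames with $f(\bigvee B)=\bigvee f[B]$ for all designated $B\subseteq L$. A frame is a complete lattice in which binary meet distributes over arbitrary joins; every frame is an $\mathcal{S}$-frame. An $\mathcal{S}$-congruence on an $\mathcal{S}$-frame $L$ is an equivalence relation $\theta\subseteq L\times L$ such that (i) $(a,b),(c,d)\in\theta$ implies $(a\wedge c,b\wedge d)\in\theta$, and (ii) if $\{(a_\alpha,b_\alpha):\alpha\in\mathcal{A}\}\subseteq\theta$ and both $\{a_\alpha:\alpha\in\mathcal{A}\}$ and $\{b_\alpha:\alpha\in\mathcal{A}\}$ are designated subsets of $L$, then $(\bigvee_\alpha a_\alpha,\bigvee_\alpha b_\alpha)\in\theta$. The set $\mathcal{C}_{\mathcal{S}}L$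 of all $\mathcal{S}$-congruences on $L$, ordered by inclusion, is a frame with meet given by intersection. The map $\nabla:L\to\mathcal{C}_{\mathcal{S}}L$ is an injective $\mathcal{S}$-frame map. For any $\mathcal{S}$-frame $L$ and $a\in L$, put $\nabla_a=\{(x,y)\in L\times L:x\vee a=y\vee a\}$ and $\Delta_a=\{(x,y)\in L\times L:x\wedge a=y\wedge a\}$; these are $\mathcal{S}$-congruences on $L$. An $\mathcal{S}$-frame map $h:L\to M$ is closed if for every $m\in M$ there is $x\in L$ with $(h\times h)^{-1}(\nabla_m)=\nabla_x$; it is open if for every $m\in M$ there is $x\in L$ with $(h\times h)^{-1}(\Delta_m)=\Delta_x$. *)

(* Defs.v *)
(* Meet-semilattices (with top) are MathComp's [tMeetSemilatticeType]; its
   boolean order and choice structure are no restriction here, since [boolp]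
   provides classical logic and choice. *)
From HB Require Import structures.
From mathcomp Require Import all_boot all_order.
From mathcomp Require Import boolp classical_sets cardinality.

Set Implicit Arguments.
Unset Strict Implicit.
Unset Printing Implicit Defensive.

Import Order.TTheory.
Local Open Scope order_scope.
Local Open Scope classical_set_scope.

Section Joins.
Context {d : Order.disp_t} {A : tMeetSemilatticeType d}.

(* Least upper bounds, made total: [join_of B] is meaningful only when
   [supremums B] is non-empty.  The library's [supremum x0] is not used because
   it sends the empty set to [x0], whereas the join of the empty set must be
   the bottom element. *)
Definition join_of (B : set A) : A := xget \top (supremums B).
Definition sjoin (x y : A) : A := join_of [set x; y].
Definition sbot : A := join_of set0.

Definition refines (X Y : set A) : Prop :=
  forall x, X x -> exists2 y, Y y & x <= y.

Definition is_complete_lattice : Prop :=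
  forall B : set A, supremums B !=set0 /\ infimums B !=set0.

Definition is_frame : Prop :=
  is_complete_lattice /\
  forall (a : A) (B : set A),
    (a `&` join_of B)%O = join_of [set (a `&` b)%O | b in B].

Definition complemented (x : A) : Prop :=
  exists y : A, (x `&` y)%O = sbot /\ sjoin x y = \top.

Definition is_boolean_frame : Prop := is_frame /\ forall x : A, complemented x.

Lemma join_ofP B : supremums B !=set0 -> supremums B (join_of B).
Proof. by case=> x Bx; rewrite /join_of; case: xgetP => // /(_ x). Qed.

Lemma join_of_eq B x : supremums B x -> join_of B = x.
Proof.
move=> Bx; apply: (@is_subset1_supremums _ _ B) => //.
by apply: join_ofP; exists x.
Qed.

End Joins.

Arguments is_frame {d} A.
Arguments is_complete_lattice {d} A.
Arguments is_boolean_frame {d} A.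

Record meet_map d d' (A : tMeetSemilatticeType d)
    (B : tMeetSemilatticeType d') := MeetMap {
  meet_map_fun :> A -> B;
  meet_mapI : {morph meet_map_fun : x y / (x `&` y)%O};
  meet_map1 : meet_map_fun \top = \top
}.

Record submeet d (A : tMeetSemilatticeType d) := SubMeet {
  submeet_set :> set A;
  submeetI : forall x y, submeet_set x -> submeet_set y ->
    submeet_set (x `&` y)%O;
  submeet1 : submeet_set \top
}.

(* A sub meet-semilattice as a meet-semilattice in its own right. *)
Section SubMeetType.
Context {d : Order.disp_t} {A : tMeetSemilatticeType d} (B : submeet A).

Definition submeet_type : Type := set_type (submeet_set B).

HB.instance Definition _ := SubChoice.copy submeet_type (set_type B).
HB.instance Definition _ :=
  Order.SubChoice_isSubPOrder.Build d A _ d submeet_type.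

Fact submeet_meet_subproof (x y : submeet_type) :
  (val x `&` val y)%O \in submeet_set B.
Proof.
by apply/mem_set/submeetI; apply/set_mem; [exact: (valP x)|exact: (valP y)].
Qed.

Definition submeet_meet (x y : submeet_type) : submeet_type :=
  Sub (val x `&` val y)%O (submeet_meet_subproof x y).

Definition submeet_top : submeet_type := Sub \top (mem_set (submeet1 B)).

Fact submeet_lexI (x y z : submeet_type) :
  (x <= submeet_meet y z) = (x <= y) && (x <= z).
Proof. by rewrite -!Order.le_val SubK lexI. Qed.

Fact submeet_lex1 (x : submeet_type) : x <= submeet_top.
Proof. by rewrite -Order.le_val SubK lex1. Qed.

HB.instance Definition _ :=
  Order.POrder_isMeetSemilattice.Build d submeet_type submeet_lexI.
HB.instance Definition _ :=
  Order.hasTop.Build d submeet_type submeet_lex1.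

End SubMeetType.

Arguments submeet_type {d A} B.

Section Image.
Context {d d' : Order.disp_t} {A : tMeetSemilatticeType d}.
Context {B : tMeetSemilatticeType d'} (f : meet_map A B).

Fact image_submeetI x y : range f x -> range f y -> range f (x `&` y)%O.
Proof. by move=> [a _ <-] [b _ <-]; exists (a `&` b)%O => //; exact: meet_mapI. Qed.

Fact image_submeet1 : range f \top.
Proof. by exists \top => //; exact: meet_map1. Qed.

Definition image_submeet : submeet B := SubMeet image_submeetI image_submeet1.

End Image.

(* Subsets of a sub meet-semilattice [B] of [A] are sets of elements of the
   subtype [submeet_type B]; [val] moves them in and out of [A]. *)
Record selection_function := SelectionFunction {
  designated :> forall d (A : tMeetSemilatticeType d), set (set A);
  sel_S1 : forall d (A : tMeetSemilatticeType d) (x : A),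
    designated [set x];
  sel_S2 : forall d (A : tMeetSemilatticeType d) (G H : set A),
    designated G -> designated H ->
    designated [set (x `&` y)%O | x in G & y in H];
  sel_S2' : forall d (A : tMeetSemilatticeType d) (G H : set A),
    designated G -> designated H ->
    (forall x y, G x -> H y -> supremums [set x; y] !=set0) ->
    designated [set sjoin x y | x in G & y in H];
  sel_S3 : forall d (A : tMeetSemilatticeType d) (G : set A) (H : A -> set A),
    designated G ->
    (forall x, G x -> designated (H x) /\ supremums (H x) x) ->
    designated (\bigcup_(x in G) H x);
  sel_S4 : forall d d' (A : tMeetSemilatticeType d)
      (B : tMeetSemilatticeType d') (f : meet_map A B),
    [set val @` T | T in @designated d' (submeet_type (image_submeet f))]
      = [set f @` G | G in @designated d A] /\
    [set f @` G | G in @designated d A] `<=` @designated d' B;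
  sel_SSub : forall d (A : tMeetSemilatticeType d) (B : submeet A) (G : set A),
    G `<=` B -> designated G ->
    @designated d (submeet_type B) (val @^-1` G);
  sel_SFin : forall d (A : tMeetSemilatticeType d) (G : set A),
    finite_set G -> designated G;
  sel_SCov : forall d (A : tMeetSemilatticeType d) (G H : set A),
    G `<=` H -> designated H -> supremums H \top -> designated G;
  sel_SRef : forall d (A : tMeetSemilatticeType d) (X Y : set A),
    designated X -> refines X Y ->
    exists C : set A, [/\ designated C, refines X C & C `<=` Y]
}.

Arguments designated S {d A} : rename.

HB.mixin Record isSFrame (S : selection_function) (d : Order.disp_t) L
    of Order.TMeetSemilattice d L := {
  designated_sup : forall B : set L, designated S B -> supremums B !=set0;
  designated_distr : forall (a : L) (B : set L), designated S B ->
    (a `&` join_of B)%O = join_of [set (a `&` b)%O | b in B]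
}.

#[short(type="sframeType")]
HB.structure Definition SFrame (S : selection_function) (d : Order.disp_t) :=
  { L of isSFrame S d L & Order.TMeetSemilattice d L }.

Record sframe_map (S : selection_function) d d' (L : sframeType S d)
    (M : sframeType S d') := SFrameMap {
  sframe_map_meet :> meet_map L M;
  sframe_map_join : forall B : set L, designated S B ->
    sframe_map_meet (join_of B) = join_of (sframe_map_meet @` B)
}.

Definition is_sframe_iso (S : selection_function) d d' (L : sframeType S d)
    (M : sframeType S d') (h : sframe_map L M) : Prop :=
  exists g : sframe_map M L, cancel h g /\ cancel g h.

(* In [scong_join] the set [R] is the family {(a_i, b_i)}, so that its two
   projections are {a_i} and {b_i}. *)
Record is_scongruence (S : selection_function) d (L : sframeType S d)
    (theta : set (L * L)) : Prop := IsSCongruence {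
  scong_refl : forall a, theta (a, a);
  scong_sym : forall a b, theta (a, b) -> theta (b, a);
  scong_trans : forall a b c, theta (a, b) -> theta (b, c) -> theta (a, c);
  scong_meet : forall a b c e, theta (a, b) -> theta (c, e) ->
    theta ((a `&` c)%O, (b `&` e)%O);
  scong_join : forall R : set (L * L), R `<=` theta ->
    designated S (fst @` R) -> designated S (snd @` R) ->
    theta (join_of (fst @` R), join_of (snd @` R))
}.

Definition nabla_set (S : selection_function) d (L : sframeType S d) (a : L) :
  set (L * L) := [set p | sjoin p.1 a = sjoin p.2 a].

Definition delta_set (S : selection_function) d (L : sframeType S d) (a : L) :
  set (L * L) := [set p | (p.1 `&` a)%O = (p.2 `&` a)%O].

Section OpenClosed.
Context {S : selection_function} {d d' : Order.disp_t}.
Context {L : sframeType S d} {M : sframeType S d'} (h : sframe_map L M).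

Definition pair_map (p : L * L) : M * M := (h p.1, h p.2).

Definition is_closed_map : Prop :=
  forall m : M, exists x : L, pair_map @^-1` nabla_set m = nabla_set x.

Definition is_open_map : Prop :=
  forall m : M, exists x : L, pair_map @^-1` delta_set m = delta_set x.

End OpenClosed.

Section SFrameTheory.
Context {S : selection_function} {d : Order.disp_t} {L : sframeType S d}.
Implicit Types (a b c x y z : L) (B : set L).

Lemma sup_designated B : designated S B -> supremums B (join_of B).
Proof. by move=> SB; exact: join_ofP (designated_sup B SB). Qed.

Lemma designated2 x y : designated S [set x; y].
Proof. by apply: sel_SFin. Qed.

Lemma join_of_ub B x : designated S B -> B x -> x <= join_of B.
Proof. by move=> /sup_designated[ubB _]; exact: ubB. Qed.

Lemma join_of_le B z : designated S B -> (forall x, B x -> x <= z) ->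
  join_of B <= z.
Proof. by move=> /sup_designated[_ lbB] Bz; apply: lbB. Qed.

Lemma sjoin_le x y z : (sjoin x y <= z) = (x <= z) && (y <= z).
Proof.
apply/idP/andP => [h|[xz yz]].
  by split; apply: le_trans h; apply: join_of_ub (designated2 _ _) _;
    [left|right].
by apply: join_of_le (designated2 _ _) _ => w [->|->].
Qed.

Lemma sjoinl x y : x <= sjoin x y.
Proof. by have := lexx (sjoin x y); rewrite sjoin_le => /andP[]. Qed.

Lemma sjoinr x y : y <= sjoin x y.
Proof. by have := lexx (sjoin x y); rewrite sjoin_le => /andP[]. Qed.

Lemma sjoinC x y : sjoin x y = sjoin y x.
Proof. by apply/le_anti; rewrite !sjoin_le !sjoinl !sjoinr. Qed.

Lemma sjoin_idPr x y : x <= y -> sjoin x y = y.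
Proof. by move=> xy; apply/le_anti; rewrite sjoin_le xy lexx sjoinr. Qed.

Lemma meet_sjoin a x y : (a `&` sjoin x y)%O = sjoin (a `&` x)%O (a `&` y)%O.
Proof.
rewrite /sjoin (designated_distr a _ (designated2 x y)); congr join_of.
apply/seteqP; split=> [_ [w [->|->] <-]|w [->|->]]; [by left|by right| |].
  by exists x => //; left.
by exists y => //; right.
Qed.

Lemma sjoin_meet c x y : sjoin c (x `&` y)%O = (sjoin c x `&` sjoin c y)%O.
Proof.
apply/le_anti/andP; split.
  rewrite sjoin_le !lexI !sjoinl /=.
  by rewrite (le_trans (leIl _ _) (sjoinr c x)) (le_trans (leIr _ _) (sjoinr c y)).
rewrite meet_sjoin sjoin_le; apply/andP; split.
  by rewrite (le_trans (leIr _ _)) ?sjoinl.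
rewrite meetC meet_sjoin sjoin_le (le_trans (leIr _ _)) ?sjoinl//=.
by rewrite meetC sjoinr.
Qed.

(* A distributed family of joins; fails for empty [B]. *)
Lemma sjoin_meet_join_of c e B : B !=set0 -> designated S B ->
  sjoin c (join_of B `&` e)%O
    = join_of [set sjoin c (b `&` e)%O | b in B].
Proof.
move=> [b0 Bb0] SB; apply/esym/join_of_eq; split.
  move=> _ [b Bb <-]; rewrite sjoin_le sjoinl /=.
  by apply: le_trans (sjoinr _ _); apply: leI2 => //; exact: join_of_ub.
move=> z zub; rewrite sjoin_le; apply/andP; split.
  by apply: le_trans (sjoinl c (b0 `&` e)%O) _; apply: zub; exists b0.
rewrite meetC (designated_distr e _ SB); apply: join_of_le.
  rewrite (_ : [set _ | _ in _] = [set (x `&` y)%O | x in [set e] & y in B]).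
    by apply: sel_S2 => //; exact: sel_S1.
  apply/seteqP; split=> [_ [b Bb <-]|_ [_ -> [b Bb <-]]]; last by exists b.
  by exists e => //; exists b.
move=> _ [b Bb <-]; rewrite meetC; apply: le_trans (sjoinr c _) _.
by apply: zub; exists b.
Qed.

Lemma designated_sjoin_meet c e B : designated S B ->
  designated S [set sjoin c (b `&` e)%O | b in B].
Proof.
move=> SB.
have SBe : designated S [set (x `&` y)%O | x in B & y in [set e]].
  by apply: sel_S2 => //; exact: sel_S1.
have := sel_S2' (sel_S1 S c) SBe.
rewrite (_ : [set sjoin x y | x in _ & y in _]
  = [set sjoin c (b `&` e)%O | b in B]); last first.
  apply/seteqP; split=> [_ [_ -> [_ [b Bb [_ -> <-]] <-]]|_ [b Bb <-]].
    by exists b.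
  by exists c => //; exists (b `&` e)%O => //; exists b => //; exists e.
by apply=> x y _ _; exact: designated_sup (designated2 x y).
Qed.

Lemma nabla_set_cong a : is_scongruence (nabla_set a).
Proof.
split; rewrite /nabla_set /=.
- by [].
- by move=> x y ->.
- by move=> x y z -> ->.
- by move=> x y z w; rewrite !(sjoinC _ a) !sjoin_meet => -> ->.
move=> R RN S1 S2; apply/le_anti.
rewrite !sjoin_le !sjoinr !andbT; apply/andP; split; apply: join_of_le => //.
  move=> _ [p Rp <-]; apply: le_trans (sjoinl _ a) _.
  rewrite (RN p Rp) sjoin_le sjoinr andbT; apply: le_trans (sjoinl _ a).
  by apply: join_of_ub => //; exists p.
move=> _ [p Rp <-]; apply: le_trans (sjoinl _ a) _.
rewrite -(RN p Rp) sjoin_le sjoinr andbT; apply: le_trans (sjoinl _ a).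
by apply: join_of_ub => //; exists p.
Qed.

End SFrameTheory.

Section CongruenceFrame.
Context {S : selection_function} {d : Order.disp_t} (L : sframeType S d).

Record scongruence := SCongruence {
  scong_set :> set (L * L);
  scong_axiom : is_scongruence scong_set
}.

HB.instance Definition _ := gen_eqMixin scongruence.
HB.instance Definition _ := gen_choiceMixin scongruence.

Lemma scong_ext (theta phi : scongruence) :
  (theta : set (L * L)) = phi -> theta = phi.
Proof.
case: theta phi => [t ht] [p hp] /= tp; subst p.
by congr SCongruence; exact: Prop_irrelevance.
Qed.

Definition scong_le (theta phi : scongruence) : bool :=
  `[< (theta : set (L * L)) `<=` phi >].

Fact scong_le_refl : reflexive scong_le.
Proof. by move=> theta; apply/asboolP. Qed.

Fact scong_le_anti : antisymmetric scong_le.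
Proof.
move=> theta phi /andP[/asboolP tp /asboolP pt].
by apply/scong_ext/seteqP.
Qed.

Fact scong_le_trans : transitive scong_le.
Proof.
move=> phi theta psi /asboolP tp /asboolP pp; apply/asboolP.
exact: subset_trans tp pp.
Qed.

HB.instance Definition _ := Order.Le_isPOrder.Build d scongruence
  scong_le_refl scong_le_anti scong_le_trans.

Fact scong_bigcap_subproof (I : set scongruence) :
  is_scongruence (\bigcap_(theta in I) (theta : set (L * L))).
Proof.
split.
- by move=> a t It; exact: (scong_refl (scong_axiom t)).
- by move=> a b h t It; apply: (scong_sym (scong_axiom t)); exact: h.
- move=> a b c h k t It.
  by apply: (scong_trans (scong_axiom t)); [exact: h|exact: k].
- move=> a b c e h k t It.
  by apply: (scong_meet (scong_axiom t)); [exact: h|exact: k].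
- move=> R h S1 S2 t It; apply: (scong_join (scong_axiom t)) => //.
  by move=> p Rp; exact: h.
Qed.

Definition scong_bigcap (I : set scongruence) : scongruence :=
  SCongruence (scong_bigcap_subproof I).

Fact scong_meet_subproof (theta phi : scongruence) :
  is_scongruence ((theta : set (L * L)) `&` phi).
Proof.
rewrite (_ : _ `&` _ = scong_bigcap [set theta; phi]); first exact: scong_axiom.
apply/seteqP; split=> [p [tp pp] t [->|->] //|p h].
by split; apply: h; [left|right].
Qed.

Definition scong_inter (theta phi : scongruence) : scongruence :=
  SCongruence (scong_meet_subproof theta phi).

Fact scong_lexI (theta phi psi : scongruence) :
  (theta <= scong_inter phi psi) = (theta <= phi) && (theta <= psi).
Proof.
apply/asboolP/andP => [h|[/asboolP h /asboolP k] p tp].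
  by split; apply/asboolP => p /h[].
by split; [exact: h|exact: k].
Qed.

HB.instance Definition _ :=
  Order.POrder_isMeetSemilattice.Build d scongruence scong_lexI.

Definition scong_top : scongruence := scong_bigcap set0.

Fact scong_lex1 (theta : scongruence) : theta <= scong_top.
Proof. by apply/asboolP => p _ t. Qed.

HB.instance Definition _ := Order.hasTop.Build d scongruence scong_lex1.

Lemma scong_leP (theta phi : scongruence) :
  reflect ((theta : set (L * L)) `<=` phi) (theta <= phi).
Proof. exact: asboolP. Qed.

Lemma scong_complete : is_complete_lattice scongruence.
Proof.
move=> B; split.
  exists (scong_bigcap (ubound B)); split.
    by move=> t Bt; apply/scong_leP => p tp u Bu; exact: (scong_leP _ _ (Bu t Bt)).
  by move=> u Bu; apply/scong_leP => p; apply.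
exists (scong_bigcap B); split.
  by move=> t Bt; apply/scong_leP => p; apply.
move=> u Bu; apply/scong_leP => p up t Bt.
exact: (scong_leP _ _ (Bu t Bt)).
Qed.

(* The Heyting implication of the congruence lattice, used to prove the frame
   law. *)
Definition scong_imp_set (theta phi : scongruence) : set (L * L) :=
  [set p | forall c e, scong_set theta (c, e) -> c <= e ->
     scong_set phi (sjoin c (p.1 `&` e)%O, sjoin c (p.2 `&` e)%O)].

Lemma scong_imp_subproof theta phi : is_scongruence (scong_imp_set theta phi).
Proof.
have P := scong_axiom phi; split; rewrite /scong_imp_set /=.
- by move=> *; exact: (scong_refl P).
- by move=> a b h c e tce ce; apply: (scong_sym P); exact: h.
- move=> a b z h k c e tce ce.
  by apply: (scong_trans P (h c e tce ce)); exact: k.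
- move=> a b x y h k c e tce ce.
  have := scong_meet P (h c e tce ce) (k c e tce ce).
  by rewrite -!sjoin_meet !(meetACA _ e _ e) !meetxx.
move=> R h S1 S2 c e tce ce.
have [->|/set0P[p0 Rp0]] := eqVneq R set0.
  by rewrite !image_set0; exact: (scong_refl P).
rewrite (@sjoin_meet_join_of _ _ _ c e (fst @` R))//; last by exists p0.1, p0.
rewrite (@sjoin_meet_join_of _ _ _ c e (snd @` R))//; last by exists p0.2, p0.
pose g (p : L * L) := (sjoin c (p.1 `&` e)%O, sjoin c (p.2 `&` e)%O).
have E1 : [set sjoin c (b `&` e)%O | b in fst @` R] = fst @` (g @` R).
  by rewrite !image_comp.
have E2 : [set sjoin c (b `&` e)%O | b in snd @` R] = snd @` (g @` R).
  by rewrite !image_comp.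
rewrite E1 E2; apply: (scong_join P).
- by move=> _ [p Rp <-]; exact: h.
- by rewrite -E1; exact: designated_sjoin_meet.
- by rewrite -E2; exact: designated_sjoin_meet.
Qed.

Definition scong_imp theta phi : scongruence :=
  SCongruence (scong_imp_subproof theta phi).

Lemma scong_join2 (theta : scongruence) a b c :
  scong_set theta (a, b) -> scong_set theta (sjoin c a, sjoin c b).
Proof.
move=> tab; pose R : set (L * L) := [set (c, c); (a, b)].
have e1 : fst @` R = [set c; a] by rewrite /R image_setU !image_set1.
have e2 : snd @` R = [set c; b] by rewrite /R image_setU !image_set1.
rewrite /sjoin -e1 -e2; apply: (scong_join (scong_axiom theta)).
- by move=> p [->|->] //; exact: (scong_refl (scong_axiom theta)).
- by rewrite e1; exact: designated2.
- by rewrite e2; exact: designated2.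
Qed.

Lemma scong_impP (theta phi psi : scongruence) :
  ((theta `&` psi)%O <= phi) = (psi <= scong_imp theta phi).
Proof.
have T := scong_axiom theta; have Q := scong_axiom psi.
have P := scong_axiom phi.
apply/scong_leP/scong_leP => [h [a b] pab c e tce ce /=|h [a b] [tab /h pab]].
  apply: h; split => /=; last first.
    by apply: scong_join2; exact: (scong_meet Q pab (scong_refl Q e)).
  have k x : scong_set theta (c, sjoin c (x `&` e)%O).
    have := scong_join2 c (scong_meet T (scong_refl T x) tce).
    by rewrite sjoinC sjoin_idPr// leIr.
  by exact: (scong_trans T (scong_sym T (k a)) (k b)).
have ka : scong_set theta ((a `&` b)%O, a).
  have := scong_meet T (scong_refl T a) (scong_sym T tab).
  by rewrite meetxx.
have kb : scong_set theta ((a `&` b)%O, b).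
  by have := scong_meet T tab (scong_refl T b); rewrite meetxx.
have := pab _ _ ka (leIl _ _); have := pab _ _ kb (leIr _ _).
rewrite /= !meetxx (meetC b a) (sjoin_idPr (lexx _)) !sjoin_idPr ?leIl ?leIr//.
by move=> h1 h2; exact: (scong_trans P h2 h1).
Qed.

Lemma scong_frame : is_frame scongruence.
Proof.
split; first exact: scong_complete.
move=> theta B; apply/esym/join_of_eq.
have [ubB lbB] := join_ofP (scong_complete B).1.
split=> [_ [b Bb <-]|phi phiub].
  by apply: leI2 => //; exact: ubB.
rewrite scong_impP; apply: lbB => b Bb; rewrite -scong_impP.
by apply: phiub; exists b.
Qed.

HB.instance Definition _ := isSFrame.Build S d scongruence
  (fun B _ => (scong_frame.1 B).1) (fun a B _ => scong_frame.2 a B).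

Definition nabla_fun (a : L) : scongruence := SCongruence (nabla_set_cong a).

Fact nabla_funI : {morph nabla_fun : a b / (a `&` b)%O}.
Proof.
have k (x c z : L) : c <= z -> sjoin (sjoin x c) z = sjoin x z.
  move=> cz; apply/le_anti; rewrite !sjoin_le !sjoinl !sjoinr /=.
  by rewrite (le_trans cz (sjoinr _ _)) (le_trans (sjoinl x c) (sjoinl _ _)).
move=> a b; apply/scong_ext/seteqP; split=> -[x y]; rewrite /nabla_set /=.
  move=> xy; split; rewrite /nabla_set /=.
    by rewrite -(k x _ _ (leIl a b)) xy k // leIl.
  by rewrite -(k x _ _ (leIr b a)) xy k // leIr.
by case; rewrite /nabla_set /= !sjoin_meet => -> ->.
Qed.

Fact nabla_fun1 : nabla_fun \top = \top.
Proof.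
apply/scong_ext/seteqP; split=> [p _ t //|[x y] _].
have k z : sjoin z \top = \top :> L by rewrite sjoin_idPr// lex1.
by rewrite /= /nabla_set /= !k.
Qed.

Definition nabla_meet : meet_map L scongruence := MeetMap nabla_funI nabla_fun1.

Fact nabla_join (B : set L) : designated S B ->
  nabla_meet (join_of B) = join_of (nabla_meet @` B).
Proof.
move=> SB; apply/esym/join_of_eq; split.
  move=> _ [b Bb <-]; apply/scong_leP => -[x y]; rewrite /= /nabla_set /= => xy.
  have bB := join_of_ub SB Bb.
  have k z : sjoin z (join_of B) = sjoin (sjoin z b) (join_of B).
    apply/le_anti; rewrite !sjoin_le !sjoinl !sjoinr /=.
    by rewrite (le_trans (sjoinl z b) (sjoinl _ _)) (le_trans bB (sjoinr _ _)).
  by rewrite (k x) xy -k.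
move=> theta tub; apply/scong_leP => -[x y]; rewrite /= /nabla_set /= => xy.
have T := scong_axiom theta.
have Bt b : B b -> scong_set theta (sbot, b).
  move=> Bb; have /scong_leP := tub _ (ex_intro2 _ _ b Bb erefl).
  apply; rewrite /= /nabla_set /= !sjoin_idPr//.
  by apply: join_of_le => //; apply: sel_SFin.
have BB : scong_set theta (sbot, join_of B).
  have [->|/set0P[b0 Bb0]] := eqVneq B set0; first exact: (scong_refl T).
  have E1 : fst @` [set (sbot : L, b) | b in B] = [set sbot].
    apply/seteqP; split=> [_ [_ [b _ <-] <-] //|_ ->].
    by exists (sbot, b0) => //; exists b0.
  have E2 : snd @` [set (sbot : L, b) | b in B] = B.
    apply/seteqP; split=> [_ [_ [b Bb <-] <-] //|b Bb].
    by exists (sbot, b) => //; exists b.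
  have := @scong_join _ _ _ _ T [set (sbot : L, b) | b in B].
  rewrite E1 E2 [join_of [set sbot]](@join_of_eq _ _ _ sbot) ?supremums1//.
  apply=> //; last exact: sel_S1.
  by move=> _ [b Bb <-]; exact: Bt.
have k z : scong_set theta (z, sjoin z (join_of B)).
  have := scong_join2 z BB; rewrite (sjoinC z sbot) sjoin_idPr//.
  by apply: join_of_le => //; apply: sel_SFin.
by apply: (scong_trans T (k x)); rewrite xy; apply: (scong_sym T); exact: k.
Qed.

Definition nabla : sframe_map L scongruence := SFrameMap nabla_join.

End CongruenceFrame.

(* Main.v *)
Require Import Defs.
From HB Require Import structures.
From mathcomp Require Import all_boot all_order.
From mathcomp Require Import boolp classical_sets cardinality.

(** Evaluating closedness, respectively openness, of [nabla] at the open
    congruence [Delta_c] (the complement of [nabla_c] among congruences) yields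
    an [x] with [Delta_c = nabla_x], respectively [nabla_c = Delta_x], and such
    an [x] is a complement of [c] in [L].  Once [L] is Boolean, a congruence is
    determined by the elements it identifies with bottom: closedness makes these
    a principal ideal, so every congruence is some [nabla_x]; openness provides
    a left adjoint of [nabla], which makes [L] complete.  Conversely, in a Boolean
    frame the join of these elements witnesses openness. *)

Set Implicit Arguments.
Unset Strict Implicit.
Unset Printing Implicit Defensive.

Import Order.TTheory.
Local Open Scope order_scope.
Local Open Scope classical_set_scope.

Section SFrameMaps.
Context {S : selection_function} {d d' : Order.disp_t}.
Context {L : sframeType S d} {M : sframeType S d'} (h : sframe_map L M).

Lemma sframe_map_sjoin x y : h (sjoin x y) = sjoin (h x) (h y).
Proof.
by rewrite (sframe_map_join h (designated2 x y)) image_setU !image_set1.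
Qed.

Lemma sframe_map_le x y : injective h -> (h x <= h y) = (x <= y).
Proof.
by move=> hI; rewrite !leEmeet -(meet_mapI h) (inj_eq hI).
Qed.

(** Being injective and meet-preserving, [h] reflects the order, so its pointwise inverse preserves
    designated joins. *)
Lemma bijective_sframe_iso :
  injective h -> (forall m, exists x, h x = m) -> is_sframe_iso h.
Proof.
move=> hI /choice[g gK].
have hK : cancel h g by move=> x; apply: hI; rewrite gK.
have gI : {morph g : x y / (x `&` y)%O}.
  by move=> x y; apply: hI; rewrite (meet_mapI h) !gK.
have g1 : g \top = \top by apply: hI; rewrite (meet_map1 h) gK.
have gJ (B : set M) : designated S B ->
    MeetMap gI g1 (join_of B) = join_of (MeetMap gI g1 @` B).
  move=> SB; apply/esym/join_of_eq; split=> /=.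
    move=> _ [b Bb <-]; rewrite -(sframe_map_le _ _ hI) !gK.
    exact: join_of_ub.
  move=> z zub; rewrite -(sframe_map_le _ _ hI) gK.
  apply: join_of_le => // b Bb; rewrite -[b]gK (sframe_map_le _ _ hI).
  by apply: zub; exists b.
by exists (SFrameMap gJ).
Qed.

Lemma sframe_iso_closed : is_sframe_iso h -> is_closed_map h.
Proof.
move=> [g [hK gK]] m; exists (g m); move: (g m) (gK m) => x <-.
apply/seteqP; split=> -[a b]; rewrite /nabla_set /= -!sframe_map_sjoin.
  exact: (can_inj hK).
by move=> ->.
Qed.

End SFrameMaps.

Section NablaMap.
Context {S : selection_function} {d : Order.disp_t} {L : sframeType S d}.
Implicit Types (a b c p q t x y z : L) (theta : scongruence L).

Lemma sbot_le x : (sbot : L) <= x.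
Proof. by apply: join_of_le => //; exact: sel_SFin. Qed.

Lemma sjoin0 x : sjoin sbot x = x.
Proof. by rewrite sjoin_idPr ?sbot_le. Qed.

Lemma meet_sbot x : (sbot `&` x)%O = sbot :> L.
Proof. exact/meet_idPl/sbot_le. Qed.

(** Joining [(sbot, a)] with [z] puts [(z, sjoin z a)] in [theta]; the pairs of [nabla L a] follow
    by transitivity. *)
Lemma nabla_leP a theta :
  nabla L a <= theta <-> scong_set theta (sbot, a).
Proof.
have T := scong_axiom theta.
split=> [/scong_leP|ta]; first by apply; rewrite /= /nabla_set /= sjoin0 sjoin_idPr.
apply/scong_leP => -[x y]; rewrite /= /nabla_set /= => xy.
have k z : scong_set theta (z, sjoin z a).
  by have := scong_join2 z ta; rewrite sjoinC sjoin0.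
by apply: (scong_trans T (k x)); rewrite xy; exact: (scong_sym T (k y)).
Qed.

Lemma nabla_le a b : (nabla L a <= nabla L b) = (a <= b).
Proof.
apply/idP/idP => [/nabla_leP|ab].
  by rewrite /= /nabla_set /= sjoin0 => ->; exact: sjoinl.
by apply/nabla_leP; rewrite /= /nabla_set /= sjoin0 sjoin_idPr.
Qed.

Lemma nabla_inj : injective (nabla L).
Proof. by move=> a b ab; apply/le_anti; rewrite -!nabla_le ab lexx. Qed.

Lemma nabla0_le theta : nabla L sbot <= theta.
Proof. exact/nabla_leP/(scong_refl (scong_axiom theta)). Qed.

Lemma delta_set_cong c : is_scongruence (delta_set c).
Proof.
split; rewrite /delta_set /=.
- by [].
- by move=> a b ->.
- by move=> a b z -> ->.
- move=> a b z w ab zw.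
  by rewrite -[c]meetxx meetACA ab zw meetACA.
move=> R RD S1 S2; rewrite !(meetC _ c) !designated_distr//; congr join_of.
rewrite !image_comp; apply: eq_imagel => p Rp /=.
by rewrite !(meetC c); exact: RD.
Qed.

Definition delta c : scongruence L := SCongruence (delta_set_cong c).

(** [nabla L c] identifies bottom with [c], and [delta c] identifies [c] with top. *)
Lemma nabla_join_delta c : sjoin (nabla L c) (delta c) = \top.
Proof.
set phi := sjoin _ _; apply/le_anti; rewrite lex1 /=.
have P := scong_axiom phi.
rewrite -(meet_map1 (nabla L)); apply/nabla_leP.
apply: (scong_trans P (b := c)); first exact/nabla_leP/sjoinl.
have /scong_leP := sjoinr (nabla L c) (delta c); apply.
by rewrite /= /delta_set /= meetxx meet1x.
Qed.

Lemma nabla_meet_delta c : (nabla L c `&` delta c <= nabla L sbot)%O.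
Proof.
apply/scong_leP => -[p q] [/=]; rewrite /nabla_set /delta_set /= => pcq pmq.
suff -> : p = q by [].
(* Absorption and distributivity: [z] is its own meet with [sjoin w c], hence the join of its meets
   with [w] and with [c]. *)
have absorb z w : sjoin z c = sjoin w c -> (z `&` c = w `&` c)%O -> z <= w.
  move=> e1 e2; rewrite -[z](meet_idPl (sjoinl z c)) e1 meet_sjoin sjoin_le.
  by rewrite e2 leIr leIl.
by apply/le_anti; rewrite !absorb.
Qed.

(** Two test pairs suffice: [(sbot, x)] gives [nabla L x <= delta c], so [c] and [x] are disjoint,
    and [(c, \top)] gives that their join is top. *)
Lemma closed_complemented c : is_closed_map (nabla L) -> complemented c.
Proof.
move=> /(_ (delta c))[x xE]; exists x; split.
  have : nabla_set x (sbot, x) by rewrite /nabla_set /= sjoin0 sjoin_idPr.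
  rewrite -xE /nabla_set /= (sjoin_idPr (nabla0_le _)) => e.
  have /nabla_leP : nabla L x <= delta c by rewrite e sjoinl.
  by rewrite /= /delta_set /= meet_sbot meetC => <-.
have : nabla_set x (c, \top).
  rewrite -xE /nabla_set /= nabla_join_delta nabla_fun1.
  by apply/le_anti; rewrite sjoinl lex1.
rewrite /nabla_set /= => ->.
by apply/le_anti; rewrite sjoinl lex1.
Qed.

(** Here [(c, sbot)] yields disjointness, while [(x, \top)] yields [delta c <= nabla L x], which is
    then applied to [(c, \top)]. *)
Lemma open_complemented c : is_open_map (nabla L) -> complemented c.
Proof.
move=> /(_ (delta c))[x xE]; exists x; split.
  have : delta_set x (c, sbot).
    rewrite -xE /delta_set /=; apply/le_anti.
    rewrite !lexI !leIr !andbT nabla_meet_delta.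
    exact: le_trans (leIl _ _) (nabla0_le _).
  by rewrite /delta_set /= meet_sbot.
have : delta_set x (x, \top) by rewrite /delta_set /= meetxx meet1x.
rewrite -xE /delta_set /= nabla_fun1 meet1x => e.
have /scong_leP/(_ (c, \top)) : delta c <= nabla L x by rewrite -e leIl.
rewrite /= /delta_set /nabla_set /= meetxx meet1x => /(_ erefl) ->.
by apply/le_anti; rewrite sjoinl lex1.
Qed.

Lemma scong_difference theta p q y :
  (q `&` y)%O = sbot -> scong_set theta (p, q) ->
  scong_set theta (sbot, (p `&` y)%O).
Proof.
move=> <- tpq; have T := scong_axiom theta.
by apply: (scong_sym T); exact: (scong_meet T tpq (scong_refl T y)).
Qed.

Lemma difference_le p q x y :
  sjoin q y = \top -> (p `&` y <= x)%O -> p <= sjoin q x.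
Proof.
move=> qy pyx; rewrite -[p]meetx1 -qy meet_sjoin sjoin_le.
by rewrite (le_trans (leIr _ _) (sjoinl _ _)) (le_trans pyx (sjoinr _ _)).
Qed.

(** If [theta] identifies [p] with [q] and [y] complements [q], the difference of [p] and [q], their
    part in [y], is congruent to bottom, hence below [x]. *)
Lemma le_nabla_complemented theta x : (forall c, complemented c) ->
  (forall t, scong_set theta (sbot, t) -> t <= x) -> theta <= nabla L x.
Proof.
move=> compl tx.
have half p q : scong_set theta (p, q) -> p <= sjoin q x.
  move=> tpq; have [y [qy0 qy1]] := compl q.
  exact: difference_le qy1 (tx _ (scong_difference qy0 tpq)).
apply/scong_leP => -[p q] tpq; rewrite /= /nabla_set /=.
apply/le_anti; rewrite !sjoin_le !sjoinr !half//.
exact: (scong_sym (scong_axiom theta) tpq).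
Qed.

Lemma closed_surjective theta : is_closed_map (nabla L) ->
  exists x, nabla L x = theta.
Proof.
move=> cl; have [x xE] := cl theta.
(* Testing closedness at [theta] on the pairs [(sbot, t)] shows that the bottom class of [theta] is
   the principal ideal of [x]. *)
have xP t : scong_set theta (sbot, t) <-> t <= x.
  transitivity (nabla_set x (sbot, t)); last first.
    rewrite /nabla_set /= sjoin0; split=> [->|tx]; first exact: sjoinl.
    by rewrite sjoin_idPr.
  rewrite -xE /nabla_set /= (sjoin_idPr (nabla0_le _)).
  split=> [/nabla_leP tt|e]; first by rewrite sjoin_idPr.
  by apply/nabla_leP; rewrite e sjoinl.
exists x; apply/le_anti/andP; split; first exact/nabla_leP/xP.
by apply: le_nabla_complemented => [c|t /xP //]; exact: closed_complemented.
Qed.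

(** Both sides assert membership of [(a, \top)] in one of the two sets that openness equates. *)
Lemma open_left_adjoint theta : is_open_map (nabla L) ->
  exists x, forall a, theta <= nabla L a <-> x <= a.
Proof.
move=> /(_ theta)[x xE]; exists x => a.
transitivity (delta_set x (a, \top)).
  rewrite -xE /delta_set /= nabla_fun1 meet1x meetC.
  by rewrite leEmeet; split=> /eqP.
by rewrite /delta_set /= meet1x meetC leEmeet; split=> /eqP.
Qed.

Lemma open_complete : is_open_map (nabla L) -> is_complete_lattice L.
Proof.
move=> op.
have sups (B : set L) : supremums B !=set0.
  have [ubB lbB] := join_ofP (scong_complete (nabla L @` B)).1.
  (* The left adjoint sends the join formed among congruences to a join in [L]. *)
  have [x xP] := open_left_adjoint (join_of (nabla L @` B)) op.
  exists x; split=> [b Bb|z zub].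
    by rewrite -nabla_le; apply: le_trans (ubB _ _) _; [exists b|apply/xP].
  by apply/xP/lbB => _ [b Bb <-]; rewrite nabla_le; exact: zub.
move=> B; split=> //.
have [x [ubx lbx]] := sups (lbound B).
by exists x; split=> // b Bb; apply: lbx => z; exact.
Qed.

(** Meeting with [a] is left adjoint to joining with a complement [y] of [a], so it preserves all
    joins. *)
Lemma complete_complemented_frame : is_complete_lattice L ->
  (forall c, complemented c) -> is_frame L.
Proof.
move=> cpl compl; split=> // a B; apply/esym/join_of_eq.
have [ubB lbB] := join_ofP (cpl B).1.
split=> [_ [b Bb <-]|z zub]; first by apply: leI2 => //; exact: ubB.
have [y [ay0 ay1]] := compl a.
have : join_of B <= sjoin y z.
  apply: lbB => b Bb; apply: difference_le (_ : (b `&` a <= z)%O).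
    by rewrite sjoinC.
  by rewrite meetC; apply: zub; exists b.
move=> /(leI2 (lexx a)) /le_trans; apply.
by rewrite meet_sjoin ay0 sjoin0 leIr.
Qed.

Lemma boolean_frame_open : is_boolean_frame L -> is_open_map (nabla L).
Proof.
move=> [[cpl distr] compl] theta.
pose K : set L := [set t | scong_set theta (sbot, t)].
have [ubK lbK] := join_ofP (cpl K).1.
exists (join_of K).
have T := scong_axiom theta.
have theta_le : theta <= nabla L (join_of K) by exact: le_nabla_complemented.
(* Below elements of the image of [nabla], [theta] can be traded for [join_of K]. As [K] need not be
   designated, the frame law of [L] enters here. *)
have leP a b : (nabla L a `&` theta <= nabla L b)%O <->
    (a `&` join_of K <= b)%O.
  split=> [h|h].
    have [_ lb] := join_ofP (cpl [set (a `&` t)%O | t in K]).1.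
    rewrite distr; apply: lb => _ [t Kt <-]; rewrite -nabla_le.
    apply: le_trans h; rewrite lexI nabla_le leIl /=; apply/nabla_leP.
    by have := scong_meet T Kt (scong_refl T a); rewrite meet_sbot meetC.
  apply: le_trans (leI2 (lexx _) theta_le) _.
  by rewrite -(meet_mapI (nabla L)) nabla_le.
(* Splitting an equality of meets into two inequalities of the shape handled by [leP]. *)
have eqI d0 (A : tMeetSemilatticeType d0) (u v w : A) :
    (u `&` w = v `&` w)%O <-> (u `&` w <= v)%O /\ (v `&` w <= u)%O.
  split=> [e|[uv vu]]; first by split; [rewrite e|rewrite -e]; exact: leIl.
  by apply/le_anti; rewrite !lexI uv vu !leIr.
apply/seteqP; split=> -[a b]; rewrite /delta_set /= => /eqI[h k]; apply/eqI.
  by split; apply: (leP _ _).1.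
by split; apply: (leP _ _).2.
Qed.

End NablaMap.

Theorem theorem7p2 (S : selection_function) (d : Order.disp_t)
    (L : sframeType S d) :
  (is_closed_map (nabla L) <-> is_sframe_iso (nabla L)) /\
  (is_open_map (nabla L) <-> is_boolean_frame L).
Proof.
split; split.
- move=> cl; apply: bijective_sframe_iso => [|theta]; first exact: nabla_inj.
  exact: closed_surjective.
- exact: sframe_iso_closed.
- move=> op; have compl c := open_complemented c op.
  by split=> //; exact: complete_complemented_frame (open_complete op) compl.
- exact: boolean_frame_open.
Qed.
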